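(* Define the sequence $(x_k)_{k\ge1}$ by $x_1=13$ and $x_{k+1}=x_k^2-1$, let $$\beta=\tfrac12\log x_1+\sum_{j=1}^\infty 2^{-j-1}\log\bigl(1-x_j^{-2}\bigr),$$ and let $\alpha=e^{2\beta/5}$ (numerically $\alpha\approx1.66928\,37234\,96921$). Then for all $n\ge1$, $$m_n\ge\lceil\alpha^{n+1}\rceil-2,$$ with equality for infinitely many $n$, and for all $n\ge8$, $$m_n\le\lfloor1.05\cdot\alpha^{n+1}\rfloor-4.$$
   Context: A rooted tree $T$ is a finite tree with a distinguished vertex, its root; its order is its number of vertices. For vertices $u,v$, the infimum of $u$ and $v$ is the vertex common to the path from $u$ to the root and the path from $v$ to the root that is furthest from the root. A set $X\subseteq V(T)$ is infima closed if the infimum of any two elements of $X$ lies in $X$. $I(T)$ denotes the number of nonempty infima closed subsets of $V(T)$. For $n\ge1$, $m_n=\min\{I(T): T \text{ a rooted tree with } n \text{ vertices}\}$. *)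

(* Defs.v *)
From Stdlib Require Import Reals ZArith.
From Coquelicot Require Import Coquelicot.

Open Scope R_scope.

(* x_1 = 13, x_{k+1} = x_k^2 - 1 ; xseq k = x_k for k >= 1 (xseq 0 unused) *)
Fixpoint xseq (k : nat) : R :=
  match k with
  | O => 13
  | S O => 13
  | S k' => xseq k' * xseq k' - 1
  end.

Definition beta : R :=
  / 2 * ln (xseq 1) +
  Series (fun i : nat => let j := S i in
            / (2 ^ (j + 1)) * ln (1 - / (xseq j ^ 2))).

Definition alpha : R := exp (2 * beta / 5).

Close Scope R_scope.

From mathcomp Require Import all_boot.
Set Implicit Arguments. Unset Strict Implicit.

(* A rooted tree of order n >= 1: vertex set 'I_n.-1.+1 (i.e. n vertices),
   root ord0, given by a parent map f with f root = root such that every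
   vertex reaches the root by iterating f (so no other cycles). Every rooted
   tree on n vertices is isomorphic to one of these. *)
Definition is_rooted_tree (N : nat) (f : {ffun 'I_N.+1 -> 'I_N.+1}) : bool :=
  (f ord0 == ord0) && [forall v, iter N.+1 f v == ord0].

Definition anc (N : nat) (f : {ffun 'I_N.+1 -> 'I_N.+1}) (u w : 'I_N.+1) : bool :=
  [exists k : 'I_N.+1, iter k f u == w].

(* w is the infimum of u and v: the common vertex of the two root paths that
   is furthest from the root (all common vertices lie on the root path of w). *)
Definition is_inf (N : nat) (f : {ffun 'I_N.+1 -> 'I_N.+1}) (u v w : 'I_N.+1) : bool :=
  [&& anc f u w, anc f v w & [forall z, (anc f u z && anc f v z) ==> anc f w z]].

Definition infima_closed (N : nat) (f : {ffun 'I_N.+1 -> 'I_N.+1})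
    (X : {set 'I_N.+1}) : bool :=
  [forall u in X, forall v in X, exists w in X, is_inf f u v w].

Definition I_T (N : nat) (f : {ffun 'I_N.+1 -> 'I_N.+1}) : nat :=
  #|[set X : {set 'I_N.+1} | (X != set0) && infima_closed f X]|.

(* m_n = min { I(T) : T rooted tree with n vertices }, for n >= 1.
   The default value 2^n bounds every I(T) from above, and the star is a
   tree, so it never affects the minimum. *)
Definition m_ (n : nat) : nat :=
  \big[minn/2 ^ n]_(f : {ffun 'I_n.-1.+1 -> 'I_n.-1.+1} | is_rooted_tree f) I_T f.

(* Main.v *)
Require Import Defs.
From Stdlib Require Import Reals ZArith.
From Stdlib Require Lra Lia.
From Coquelicot Require Coquelicot.
From mathcomp Require all_boot zify.

(* A set containing the root is infima closed iff its trace on every branch is;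
   a nonempty one avoiding the root lies in a single branch.  Hence
   I(T) = prod (1 + I(T_i)) + sum I(T_i) over the branches T_i, and for
   F = I + 2 two branches combine as F = F_1 F_2 - 1.  Joining two copies of the
   star of order 4 (F = 13), then two copies of the result, and so on, gives
   trees of order 5 * 2^(k-1) - 1 with F = x_k, and alpha^(5 * 2^(k-1)) lies in
   [x_k - 1/x_k, x_k].

   Lower bound: F >= g(alpha^(n+1)) by induction on trees, where g is the
   function with g(y^2) = g(y)^2 - 1 and g(y) ~ y; it satisfies
   sqrt (1 + y^2) <= g(y) <= y + 1/y.  Two branches of equal order are exactly
   the functional equation; in all other cases the two estimates of g suffice.

   Upper bound: start from trees of order 8, ..., 12 and write the order as
   s + 5 q; each binary digit of q is realised by joining one of the extremal
   trees above, whose ratios F / alpha^(n+1) have a product below 1.00301. *)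

(** * The constant alpha *)

Module GrowthConstant.
Import Lra Lia Coquelicot.Coquelicot.
Open Scope R_scope.

Lemma xseq_rec (k : nat) : xseq (S (S k)) = xseq (S k) * xseq (S k) - 1.
Proof. reflexivity. Qed.

Lemma xseq_ge (k : nat) : 13 <= xseq (S k).
Proof.
  induction k as [|k IH]; [simpl; lra|].
  rewrite xseq_rec; nra.
Qed.

Lemma xseq_integer (k : nat) : exists z : Z, xseq (S k) = IZR z.
Proof.
  induction k as [|k [z IH]]; [exists 13%Z; reflexivity|].
  exists (z * z - 1)%Z; rewrite xseq_rec, IH, minus_IZR, mult_IZR; reflexivity.
Qed.

(** * Two-sided bounds for [beta] *)

Definition upper_log (k : nat) : R := ln (xseq (S k)) / 2 ^ (S k).
Definition lower_log (k : nat) : R :=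
  ln (xseq (S k) - / xseq (S k)) / 2 ^ (S k).

Definition beta_term (i : nat) : R :=
  / (2 ^ (S i + 1)) * ln (1 - / (xseq (S i) ^ 2)).

Lemma xseq_inv_bounds (k : nat) : 0 < / xseq (S k) <= / 13.
Proof.
  pose proof (xseq_ge k); split; [apply Rinv_0_lt_compat; lra|].
  apply Rinv_le_contravar; lra.
Qed.

Lemma xseq_inv_sq_bounds (k : nat) : 0 < / (xseq (S k) ^ 2) < 1.
Proof.
  pose proof (xseq_inv_bounds k); rewrite <- pow_inv.
  replace ((/ xseq (S k)) ^ 2) with (/ xseq (S k) * / xseq (S k)) by ring.
  split; nra.
Qed.

(** Factoring [x^2 - 1 = x^2 (1 - x^-2)] inside the logarithm makes the recurrence telescope, so
    [upper_log] runs through the partial sums of the series in [beta]. *)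
Lemma upper_log_S (k : nat) : upper_log (S k) = upper_log k + beta_term k.
Proof.
  pose proof (xseq_ge k) as Hx; pose proof (xseq_inv_sq_bounds k) as Hi.
  unfold upper_log, beta_term; rewrite xseq_rec.
  replace (xseq (S k) * xseq (S k) - 1)
    with (xseq (S k) * xseq (S k) * (1 - / (xseq (S k) ^ 2))) by (field; lra).
  rewrite ln_mult by nra; rewrite ln_mult by lra.
  rewrite Nat.add_1_r; simpl; field; apply pow_nonzero; lra.
Qed.

Lemma beta_term_neg (i : nat) : beta_term i <= 0.
Proof.
  pose proof (xseq_inv_sq_bounds i) as Hi; unfold beta_term.
  assert (ln (1 - / (xseq (S i) ^ 2)) < ln 1) by (apply ln_increasing; lra).
  rewrite ln_1 in *.
  assert (0 < / 2 ^ (S i + 1)) by (apply Rinv_0_lt_compat, pow_lt; lra).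
  nra.
Qed.

(* With [w = x - 1/x] one has [w^2 <= w'] for the next term [x' = x^2 - 1],
   so [w] bounds the limit from below as [x] bounds it from above. *)
Lemma lower_log_incr (k : nat) : lower_log k <= lower_log (S k).
Proof.
  pose proof (xseq_ge k) as Hx; pose proof (xseq_inv_bounds k) as Hi.
  pose proof (xseq_inv_bounds (S k)) as Hi'; pose proof (xseq_ge (S k)) as Hx'.
  unfold lower_log.
  assert (Hw : 0 < xseq (S k) - / xseq (S k)) by lra.
  replace (ln (xseq (S k) - / xseq (S k)) / 2 ^ S k) with
    (ln ((xseq (S k) - / xseq (S k)) * (xseq (S k) - / xseq (S k))) / 2 ^ S (S k)).
  2:{ rewrite ln_mult by lra; simpl; field; apply pow_nonzero; lra. }
  apply Rmult_le_compat_r.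
  { left; apply Rinv_0_lt_compat, pow_lt; lra. }
  apply ln_le; [nra|].
  rewrite xseq_rec in *.
  assert (Hm : xseq (S k) * / xseq (S k) = 1) by (field; lra).
  nra.
Qed.

Lemma lower_log_le_upper_log (k : nat) : lower_log k <= upper_log k.
Proof.
  pose proof (xseq_ge k) as Hx; pose proof (xseq_inv_bounds k) as Hi.
  apply Rmult_le_compat_r.
  { left; apply Rinv_0_lt_compat, pow_lt; lra. }
  apply ln_le; lra.
Qed.

Lemma upper_log_decr (k : nat) : upper_log (S k) <= upper_log k.
Proof. rewrite upper_log_S; pose proof (beta_term_neg k); lra. Qed.

Lemma lower_log_mono (k l : nat) : lower_log k <= lower_log (l + k).
Proof.
  induction l as [|l IH]; [apply Rle_refl|].
  eapply Rle_trans; [exact IH | apply lower_log_incr].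
Qed.

Lemma upper_log_mono (k l : nat) : upper_log (l + k) <= upper_log k.
Proof.
  induction l as [|l IH]; [apply Rle_refl|].
  eapply Rle_trans; [apply upper_log_decr | exact IH].
Qed.

Lemma sum_beta_term (n : nat) :
  sum_n beta_term n = upper_log (S n) - upper_log 0.
Proof.
  induction n as [|n IH].
  - rewrite sum_O, upper_log_S.
    change (beta_term 0 = upper_log 0 + beta_term 0 - upper_log 0); ring.
  - rewrite sum_Sn, IH, (upper_log_S (S n)).
    change (upper_log (S n) - upper_log 0 + beta_term (S n)
      = upper_log (S n) + beta_term (S n) - upper_log 0); ring.
Qed.

(** [Series] is a total function, so convergence comes first: [upper_log] decreases and stays above
    [lower_log 0]. *)
Lemma is_lim_upper_log : is_lim_seq upper_log beta.
Proof.
  assert (Hex : ex_finite_lim_seq upper_log).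
  { apply ex_finite_lim_seq_decr with (lower_log 0); [exact upper_log_decr|].
    intros n; eapply Rle_trans; [|apply lower_log_le_upper_log].
    rewrite <- (Nat.add_0_r n); apply lower_log_mono. }
  destruct Hex as [l Hl].
  assert (Hs : is_series beta_term (l - upper_log 0)).
  { change (is_lim_seq (sum_n beta_term) (l - upper_log 0)).
    apply is_lim_seq_ext with (fun n => upper_log (S n) - upper_log 0).
    { intros n; symmetry; apply sum_beta_term. }
    apply is_lim_seq_minus'; [apply is_lim_seq_incr_1 in Hl; exact Hl|].
    apply is_lim_seq_const. }
  apply is_series_unique in Hs.
  replace beta with l; [exact Hl|].
  change beta with (/ 2 * ln (xseq 1) + Series beta_term).
  rewrite Hs; unfold upper_log; simpl; lra.
Qed.

Lemma beta_bounds (k : nat) : lower_log k <= beta <= upper_log k.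
Proof.
  pose proof (is_lim_seq_incr_n upper_log k beta) as [Hshift _].
  specialize (Hshift is_lim_upper_log).
  split.
  - apply (is_lim_seq_le (fun _ => lower_log k) (fun n => upper_log (n + k))
             (lower_log k) beta); [|apply is_lim_seq_const|exact Hshift].
    intros n; eapply Rle_trans; [apply lower_log_mono|apply lower_log_le_upper_log].
  - apply (is_lim_seq_le (fun n => upper_log (n + k)) (fun _ => upper_log k)
             beta (upper_log k)); [|exact Hshift|apply is_lim_seq_const].
    intros n; apply upper_log_mono.
Qed.

(** * Powers of [alpha] *)

Lemma alpha_pow (k : nat) : alpha ^ (5 * 2 ^ k) = exp (2 ^ (S k) * beta).
Proof.
  assert (Hexp : forall (n : nat) (t : R), exp t ^ n = exp (INR n * t)).
  { induction n as [|n IH]; intros t; [simpl; rewrite Rmult_0_l, exp_0; reflexivity|].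
    rewrite S_INR; simpl; rewrite IH, <- exp_plus; f_equal; ring. }
  unfold alpha; rewrite Hexp; f_equal.
  rewrite mult_INR, pow_INR.
  replace (INR 5) with 5 by (simpl; ring); replace (INR 2) with 2 by (simpl; ring).
  simpl; field.
Qed.

Lemma exp_le (s t : R) : s <= t -> exp s <= exp t.
Proof.
  intros [H|H]; [left; apply exp_increasing, H | rewrite H; apply Rle_refl].
Qed.

Lemma alpha_pow_bounds (k : nat) :
  xseq (S k) - / xseq (S k) <= alpha ^ (5 * 2 ^ k) <= xseq (S k).
Proof.
  pose proof (xseq_ge k) as Hx; pose proof (xseq_inv_bounds k) as Hi.
  rewrite alpha_pow.
  destruct (beta_bounds k) as [Hl Hu]; unfold lower_log, upper_log in *.
  assert (H2 : 0 < 2 ^ S k) by (apply pow_lt; lra).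
  split.
  - rewrite <- (exp_ln (xseq (S k) - / xseq (S k))) by lra.
    apply exp_le.
    apply Rmult_le_reg_r with (/ 2 ^ S k); [apply Rinv_0_lt_compat; lra|].
    replace (2 ^ S k * beta * / 2 ^ S k) with beta by (field; lra).
    exact Hl.
  - rewrite <- (exp_ln (xseq (S k))) by lra.
    apply exp_le.
    apply Rmult_le_reg_r with (/ 2 ^ S k); [apply Rinv_0_lt_compat; lra|].
    replace (2 ^ S k * beta * / 2 ^ S k) with beta by (field; lra).
    exact Hu.
Qed.

Lemma alpha_bounds_sharp : 1669283 / 1000000 < alpha < 1669284 / 1000000.
Proof.
  assert (Ha : 0 < alpha) by apply exp_pos.
  (* This puts [alpha ^ 20] within [1 / 28223] of [x_3 = 28223], so comparing 20th powers
     suffices. *)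
  pose proof (alpha_pow_bounds 2) as [Hl Hu]; simpl (5 * 2 ^ 2)%nat in *.
  rewrite !xseq_rec in *; simpl xseq in *.
  split; apply Rnot_le_lt; intros Hc.
  - pose proof (pow_incr alpha (1669283 / 1000000) 20); lra.
  - pose proof (pow_incr (1669284 / 1000000) alpha 20); lra.
Qed.

Lemma alpha_bounds : 166928 / 100000 < alpha < 166929 / 100000.
Proof. pose proof alpha_bounds_sharp; lra. Qed.

End GrowthConstant.

(** * Counting infima closed sets *)

Module Trees.
Import all_boot zify.
Local Open Scope nat_scope.
Set Implicit Arguments.
Unset Strict Implicit.

(** Bounding the number of steps by the order loses nothing, since [findex] stays below the size of
    the orbit. *)
Lemma ancE (N : nat) (f : {ffun 'I_N.+1 -> 'I_N.+1}) (u w : 'I_N.+1) :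
  anc f u w = fconnect f u w.
Proof.
apply/existsP/idP => [[k /eqP <-]|uw]; first exact: fconnect_iter.
have ltk : findex f u w < N.+1.
  by apply: leq_trans (findex_max uw) _; rewrite -[X in _ <= X]card_ord max_card.
by exists (Ordinal ltk); rewrite /= iter_findex.
Qed.

(** * The ancestor order of a rooted tree *)

Section Rooted.
Variables (N : nat) (f : {ffun 'I_N.+1 -> 'I_N.+1}).
Hypothesis treef : is_rooted_tree f.
Implicit Types (u v w c : 'I_N.+1) (X : {set 'I_N.+1}).

Let f0 : f ord0 = ord0.
Proof. by case/andP: treef => /eqP. Qed.

Lemma iter_root n u : N < n -> iter n f u = ord0.
Proof.
move=> /subnK <-; rewrite iterD.
case/andP: treef => _ /forallP /(_ u) /eqP ->.
by elim: (n - N.+1) => //= k ->.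
Qed.

Lemma anc_root u : fconnect f u ord0.
Proof. by rewrite -(@iter_root N.+1 u) // fconnect_iter. Qed.

(** Going round the cycle [N.+1] times takes more than [N] steps and hence ends at the root. *)
Lemma iter_fixed_root k u : iter k.+1 f u = u -> u = ord0.
Proof.
move=> uk.
have um m : iter (m * k.+1) f u = u.
  by elim: m => // m IH; rewrite mulSn iterD IH.
by rewrite -(um N.+1) iter_root // mulnS leq_addr.
Qed.

Lemma anc_antisym u v : fconnect f u v -> fconnect f v u -> u = v.
Proof.
move=> uv vu; have := iter_findex uv; have := iter_findex vu.
set k := findex f v u; set l := findex f u v => vk ul.
case: l ul => [//|l] ul; have := vk; rewrite -ul -iterD addnS => uu.
have u0 := iter_fixed_root uu; rewrite u0.
by elim: l.+1 {ul uu} => //= m <-; rewrite f0.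
Qed.

Lemma anc_total u v w :
  fconnect f u v -> fconnect f u w -> fconnect f v w || fconnect f w v.
Proof.
move=> /iter_findex <- /iter_findex <-.
move: (findex f u v) (findex f u w) => k l.
by case/orP: (leq_total k l) => /subnK <-; rewrite iterD fconnect_iter ?orbT.
Qed.

Lemma anc_parent u v : fconnect f u v -> u != v -> fconnect f (f u) v.
Proof.
move=> /iter_findex; case: (findex f u v) => [/= ->|k]; first by rewrite eqxx.
by rewrite iterSr => <- _; apply: fconnect_iter.
Qed.

(** The parent map fixes the root; [c != v] keeps the root from being its own child. *)
Definition child v c := (f c == v) && (c != v).

Definition desc v : {set 'I_N.+1} := [set u | fconnect f u v].

Lemma child_anc v c : child v c -> fconnect f c v.
Proof. by case/andP => /eqP <- _; apply: fconnect1. Qed.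

Lemma child_not_anc v c : child v c -> fconnect f v c = false.
Proof.
move=> vc; apply/negP => /anc_antisym /(_ (child_anc vc)) eq_vc.
by case/andP: vc => _; rewrite eq_vc eqxx.
Qed.

(** Two siblings above the same vertex are comparable; were they distinct, the parent [v] of one
    would have the other, its own child, as an ancestor. *)
Lemma child_uniq v c c' u : child v c -> child v c' ->
  fconnect f u c -> fconnect f u c' -> c = c'.
Proof.
wlog cc' : c c' / fconnect f c c' => [hw vc vc' uc uc'|vc vc' _ _].
  case/orP: (anc_total uc uc') => h; first exact: hw.
  by symmetry; apply: hw.
apply/eqP/negP => /negP /(anc_parent cc').
by case/andP: (vc) => /eqP -> _; rewrite child_not_anc.
Qed.

Lemma descP v u : reflect (u = v \/ exists2 c, child v c & fconnect f u c)
  (fconnect f u v).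
Proof.
apply: (iffP idP) => [uv|[->|[c vc uc]]] //; last first.
  exact: connect_trans uc (child_anc vc).
move: (iter_findex uv); elim: (findex f u v) => [/= ->|k IH /= fk]; first by left.
have [/IH //|neq] := eqVneq (iter k f u) v.
by right; exists (iter k f u); rewrite ?fconnect_iter // /child fk eqxx.
Qed.

Lemma is_infE u v w : reflect
  [/\ fconnect f u w, fconnect f v w &
      forall z, fconnect f u z -> fconnect f v z -> fconnect f w z]
  (is_inf f u v w).
Proof.
rewrite /is_inf !ancE; apply: (iffP and3P) => -[uw vw h]; split=> //.
  by move=> z uz vz; have := forallP h z; rewrite !ancE uz vz.
by apply/forallP => z; rewrite !ancE; apply/implyP => /andP[]; apply: h.
Qed.

Lemma is_inf_uniq u v w w' : is_inf f u v w -> is_inf f u v w' -> w = w'.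
Proof.
by move=> /is_infE[uw vw h] /is_infE[uw' vw' h']; apply: anc_antisym; auto.
Qed.

Lemma is_inf_anc u v : fconnect f u v -> is_inf f u v v.
Proof. by move=> uv; apply/is_infE; split. Qed.

Lemma is_inf_sym u v w : is_inf f u v w -> is_inf f v u w.
Proof. by move=> /is_infE[uw vw h]; apply/is_infE; split=> // z vz uz; apply: h. Qed.

(** A common ancestor [z] is comparable with [c]. At or below [c] it would make [c] an ancestor of
    [u'], against the disjointness of branches; so it lies at [v] or above. *)
Lemma is_inf_children v c c' u u' : child v c -> child v c' -> c != c' ->
  fconnect f u c -> fconnect f u' c' -> is_inf f u u' v.
Proof.
move=> vc vc' cc' uc uc'; apply/is_infE; split.
- exact: connect_trans uc (child_anc vc).
- exact: connect_trans uc' (child_anc vc').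
move=> z uz u'z.
have hc : fconnect f u' c -> False.
  by move=> u'c; case/eqP: cc'; apply: (child_uniq vc vc' u'c uc').
case/orP: (anc_total uc uz) => [cz|zc]; last first.
  by case: hc; apply: connect_trans u'z zc.
have [eqcz|/(anc_parent cz)] := eqVneq c z; first by case: hc; rewrite eqcz.
by case/andP: vc => /eqP ->.
Qed.

Lemma closedP X : reflect (forall u u', u \in X -> u' \in X ->
    exists2 w, w \in X & is_inf f u u' w) (infima_closed f X).
Proof.
apply: (iffP forall_inP) => [h u u' uX u'X|h u uX].
  have := h u uX; move=> /forall_inP hu; have := hu u' u'X; move=> /exists_inP[w wX iw].
  by exists w.
apply/forall_inP => u' u'X; apply/exists_inP.
by have [w wX iw] := h u u' uX u'X; exists w.
Qed.

(** * The recursion for the number of closed sets *)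

Definition closed_in v : {set {set 'I_N.+1}} :=
  [set X | infima_closed f X & X \subset desc v].

Definition nb_closed v := #|[set X in closed_in v | X != set0]|.

(** The empty set counts in [closed_in] but not in [nb_closed]; it is the [1 +] in each factor of
    the recursion and stands for a branch that is not met. *)
Lemma card_closed_in v : #|closed_in v| = (nb_closed v).+1.
Proof.
rewrite /nb_closed (cardsD1 set0) inE sub0set andbT.
have -> : infima_closed f set0 by apply/closedP => u u'; rewrite inE.
by congr _.+1; apply: eq_card => X; rewrite !inE andbC.
Qed.

Lemma closed_restrict X v : infima_closed f X -> X :&: desc v \in closed_in v.
Proof.
move=> /closedP clX; rewrite inE subsetIr andbT; apply/closedP => u u'.
rewrite !inE => /andP[uX uv] /andP[u'X u'v].
have [w wX iw] := clX u u' uX u'X; exists w => //; rewrite !inE wX.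
by case/is_infE: iw => _ _; apply.
Qed.

Definition glue v (h : {ffun 'I_N.+1 -> {set 'I_N.+1}}) :=
  v |: \bigcup_(c | child v c) h c.

(** The value [set0] off the children puts the family of traces in a [pfamily], whose cardinality is
    a product; [glue] is the inverse map on sets containing [v]. *)
Definition cut v X : {ffun 'I_N.+1 -> {set 'I_N.+1}} :=
  [ffun c => if child v c then X :&: desc c else set0].

Lemma glueK v h : h \in pfamily set0 (child v) closed_in -> cut v (glue v h) = h.
Proof.
move=> /pfamilyP[sh hcl]; apply/ffunP => c; rewrite ffunE.
case: ifP => vc; last first.
  apply/eqP; rewrite eq_sym; apply/negPn/negP => hc0.
  by have := subsetP sh c hc0; rewrite -topredE /= vc.
apply/setP => u; rewrite !inE.
have sub c' : child v c' -> {subset h c' <= desc c'}.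
  by move=> vc'; apply/subsetP; have := hcl c' vc'; rewrite inE => /andP[].
apply/andP/idP => [[/orP[/eqP->|/bigcupP[c' vc' uc']] uc]|uc].
- by rewrite child_not_anc in uc.
- suff -> : c = c' by [].
  by apply: (child_uniq vc vc' uc); have := sub _ vc' _ uc'; rewrite inE.
- split; first by apply/orP; right; apply/bigcupP; exists c.
  by have := sub _ vc _ uc; rewrite inE.
Qed.

Lemma cutK v X : X \subset desc v -> v \in X -> glue v (cut v X) = X.
Proof.
move=> Xv vX; apply/setP => u; rewrite !inE.
apply/orP/idP => [[/eqP->//|/bigcupP[c vc]]|uX].
  by rewrite ffunE vc inE => /andP[].
have := subsetP Xv u uX; rewrite inE => /descP[->|[c vc uc]]; first by left.
by right; apply/bigcupP; exists c; rewrite // ffunE vc !inE uX.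
Qed.

(** Elements of different branches have infimum [v], which was added; within one branch the given
    set is already closed. *)
Lemma glue_closed v h : h \in pfamily set0 (child v) closed_in ->
  glue v h \in closed_in v.
Proof.
move=> /pfamilyP[sh hcl].
have sub c u : child v c -> u \in h c -> fconnect f u c.
  by move=> vc uc; have := hcl c vc; rewrite inE => /andP[_ /subsetP/(_ u uc)]; rewrite inE.
have subv : glue v h \subset desc v.
  apply/subsetP => u; rewrite !inE => /orP[/eqP->//|/bigcupP[c vc uc]].
  by apply/descP; right; exists c; rewrite // sub.
rewrite inE subv andbT; apply/closedP => u u' uX u'X.
have vX : v \in glue v h by rewrite !inE eqxx.
have uv : fconnect f u v by have := subsetP subv u uX; rewrite inE.
have u'v : fconnect f u' v by have := subsetP subv u' u'X; rewrite inE.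
move: uX u'X; rewrite !inE.
case/orP => [/eqP->|/bigcupP[c vc uc]].
  by move=> _; exists v => //; apply/is_inf_sym/is_inf_anc.
case/orP => [/eqP->|/bigcupP[c' vc' uc']].
  by exists v => //; apply: is_inf_anc.
have [eqc|neq] := eqVneq c c'; last first.
  by exists v => //; apply: (is_inf_children vc vc' neq); apply: sub.
rewrite -eqc in uc'; have := hcl c vc.
rewrite inE => /andP[/closedP/(_ u u' uc uc')[w wc iw] _].
by exists w => //; rewrite !inE; apply/orP; right; apply/bigcupP; exists c.
Qed.

Lemma card_closed_with v :
  #|[set X in closed_in v | v \in X]| = \prod_(c | child v c) (nb_closed c).+1.
Proof.
rewrite -[LHS](@card_in_imset _ _ (cut v)); last first.
  move=> X Y; rewrite !inE => /andP[/andP[_ Xv] vX] /andP[/andP[_ Yv] vY] eqc.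
  by rewrite -(cutK Xv vX) eqc cutK.
transitivity #|pfamily set0 (child v) closed_in|.
  apply: eq_card => h; apply/imsetP/idP => [[X] | hP].
    rewrite !inE => /andP[/andP[clX _] _] ->.
    apply/pfamilyP; split.
      by apply/subsetP => c; rewrite !inE ffunE; case: ifP; rewrite ?eqxx.
    by move=> c vc; rewrite ffunE ifT // closed_restrict.
  exists (glue v h); last by rewrite glueK.
  by rewrite !inE eqxx andbT; have := glue_closed hP; rewrite inE.
rewrite card_pfamily foldrE big_map big_enum /=.
by apply: eq_bigr => c _; rewrite card_closed_in.
Qed.

(** Double counting: a nonempty closed set avoiding [v] lies below exactly one child, since elements
    of two branches would force their infimum [v] into it. *)
Lemma card_closed_without v :
  #|[set X in closed_in v | (v \notin X) && (X != set0)]| =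
  \sum_(c | child v c) nb_closed c.
Proof.
under [RHS]eq_bigr => c _ do rewrite /nb_closed -sum1_card big_mkcond.
rewrite exchange_big -sum1_card big_mkcond; apply: eq_bigr => X _ /=.
rewrite -big_mkcondr sum1dep_card.
have [XP|XP] := boolP (X \in [set X in closed_in v | (v \notin X) && (X != set0)]).
  move: XP; rewrite !inE => /andP[/andP[clX Xv] /andP[vX X0]].
  have [x xX] := set0Pn _ X0.
  have := subsetP Xv x xX; rewrite inE => /descP[eqx|[c vc xc]].
    by rewrite -eqx xX in vX.
  have Xc : X \subset desc c.
    apply/subsetP => y yX.
    have := subsetP Xv y yX; rewrite !inE => /descP[eqy|[c' vc' yc']].
      by rewrite -eqy yX in vX.
    have [->//|neq] := eqVneq c c'.
    have iv := is_inf_children vc vc' neq xc yc'.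
    have /closedP/(_ x y xX yX)[w wX iw] := clX.
    by rewrite (is_inf_uniq iv iw) wX in vX.
  rewrite -(card1 c); apply: eq_card => c'; rewrite !inE clX X0 /= andbT.
  apply/idP/andP => [/eqP->|[vc' /subsetP/(_ x xX)]] //.
  by rewrite inE => xc'; apply/eqP; apply: (child_uniq vc' vc xc' xc).
apply/esym/eqP; rewrite -leqn0 leqNgt; apply/negP => /card_gt0P[c].
rewrite !inE => /andP[vc /andP[/andP[clX Xc] X0]].
case/negP: XP; rewrite !inE clX X0 andbT /=; apply/andP; split.
  apply/subsetP => x /(subsetP Xc); rewrite !inE => xc.
  exact: connect_trans xc (child_anc vc).
by apply/negP => /(subsetP Xc); rewrite inE child_not_anc.
Qed.

Lemma nb_closed_rec v : nb_closed v =
  \prod_(c | child v c) (nb_closed c).+1 + \sum_(c | child v c) nb_closed c.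
Proof.
rewrite -card_closed_with -card_closed_without /nb_closed.
rewrite -(cardsID [set X : {set 'I_N.+1} | v \in X]); congr (_ + _).
  apply: eq_card => X; rewrite !inE -andbA; congr (_ && _).
  rewrite andb_idl // => vX; by apply/set0Pn; exists v.
by apply: eq_card => X; rewrite !inE andbC -!andbA; do !bool_congr.
Qed.

Lemma card_desc v : #|desc v| = (\sum_(c | child v c) #|desc c|).+1.
Proof.
rewrite (cardsD1 v) inE connect0; congr _.+1.
under [RHS]eq_bigr => c _ do rewrite -sum1_card big_mkcond.
rewrite exchange_big -sum1_card big_mkcond; apply: eq_bigr => x _ /=.
rewrite -big_mkcondr sum1dep_card !inE.
have [->|neq] /= := eqVneq x v.
  apply/esym/eqP; rewrite -leqn0 leqNgt; apply/negP => /card_gt0P[c].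
  by rewrite !inE => /andP[/child_not_anc ->].
case: ifP => [/descP[eqx|[c vc xc]]|xv].
- by rewrite eqx eqxx in neq.
- rewrite -(card1 c); apply: eq_card => c'; rewrite !inE.
  apply/idP/andP => [/eqP->|[vc' xc']] //.
  by apply/eqP; apply: (child_uniq vc' vc xc' xc).
- apply/esym/eqP; rewrite -leqn0 leqNgt; apply/negP => /card_gt0P[c].
  rewrite !inE => /andP[vc xc]; move: xv.
  by rewrite (connect_trans xc (child_anc vc)).
Qed.

Lemma card_desc_child v c : child v c -> #|desc c| < #|desc v|.
Proof. by move=> vc; rewrite (card_desc v) ltnS (bigD1 c) //= leq_addr. Qed.

Lemma desc_root : desc ord0 = setT.
Proof. by apply/setP => u; rewrite !inE anc_root. Qed.

Lemma I_T_nb_closed : I_T f = nb_closed ord0.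
Proof.
by apply: eq_card => X; rewrite !inE desc_root subsetT andbT andbC.
Qed.

End Rooted.

(** The induction runs over the vertices of one fixed tree, by the size of [desc v], so branches
    need not be rebuilt as trees. The pairs in [s] are counts and orders of branches. *)
Lemma I_T_ind (Q : nat -> nat -> Prop) :
  (forall s : seq (nat * nat), (forall p, p \in s -> Q p.1 p.2) ->
    Q (\prod_(p <- s) p.1.+1 + \sum_(p <- s) p.1) (\sum_(p <- s) p.2).+1) ->
  forall (N : nat) (f : {ffun 'I_N.+1 -> 'I_N.+1}),
    is_rooted_tree f -> Q (I_T f) N.+1.
Proof.
move=> hQ N f tf; rewrite I_T_nb_closed //.
have <- : #|desc f ord0| = N.+1 by rewrite desc_root // cardsT card_ord.
move: ord0 => v; have [n] := ubnP #|desc f v|.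
elim: n v => // n IH v ltn; rewrite nb_closed_rec // card_desc //.
have := hQ [seq (nb_closed f c, #|desc f c|) | c <- enum (child f v)].
rewrite !big_map !big_enum /=; apply => p /mapP[c]; rewrite mem_enum => vc -> /=.
by apply: IH; apply: leq_trans (card_desc_child tf vc) _.
Qed.

(** [nb_closed] depends only on the child relation below a vertex; this identifies the branches of a
    joined tree with the original trees. *)
Lemma nb_closed_embed (N M : nat) (f : {ffun 'I_N.+1 -> 'I_N.+1})
    (g : {ffun 'I_M.+1 -> 'I_M.+1}) (phi : 'I_N.+1 -> 'I_M.+1) :
  is_rooted_tree f -> is_rooted_tree g -> injective phi ->
  (forall v, [set c | child g (phi v) c] = phi @: [set c | child f v c]) ->
  forall v, nb_closed g (phi v) = nb_closed f v.
Proof.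
move=> tf tg phi_inj hphi v; have [n] := ubnP #|desc f v|.
elim: n v => // n IH v ltn.
have IHc c : child f v c -> nb_closed g (phi c) = nb_closed f c.
  by move=> vc; apply: IH; apply: leq_trans (card_desc_child tf vc) _.
have hl c : child g (phi v) c = (c \in phi @: [set c | child f v c]).
  by rewrite -hphi inE.
rewrite (nb_closed_rec tg) (nb_closed_rec tf) !(eq_bigl _ _ hl).
rewrite !big_imset /=; try by move=> ? ? _ _; apply: phi_inj.
by congr (_ + _); apply: eq_big => c; rewrite inE // => /IHc ->.
Qed.

(** Both trees are shifted behind a new root [ord0]. Each old root is its own parent in its tree,
    hence the explicit redirection. *)
Definition join (N1 N2 : nat) (f1 : {ffun 'I_N1.+1 -> 'I_N1.+1})
    (f2 : {ffun 'I_N2.+1 -> 'I_N2.+1}) :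
    {ffun 'I_(N1.+1 + N2.+1).+1 -> 'I_(N1.+1 + N2.+1).+1} :=
  [ffun x => match unlift ord0 x with
    | None => ord0
    | Some y => match split y with
      | inl i => if i == ord0 then ord0 else lift ord0 (lshift _ (f1 i))
      | inr j => if j == ord0 then ord0 else lift ord0 (rshift _ (f2 j))
      end
    end].

Section Join.
Variables (N1 N2 : nat) (f1 : {ffun 'I_N1.+1 -> 'I_N1.+1}).
Variable f2 : {ffun 'I_N2.+1 -> 'I_N2.+1}.
Hypotheses (tree1 : is_rooted_tree f1) (tree2 : is_rooted_tree f2).
Let g := join f1 f2.
Let phi1 (i : 'I_N1.+1) : 'I_(N1.+1 + N2.+1).+1 := lift ord0 (lshift _ i).
Let phi2 (j : 'I_N2.+1) : 'I_(N1.+1 + N2.+1).+1 := lift ord0 (rshift _ j).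

Lemma join0 : g ord0 = ord0.
Proof. by rewrite ffunE unlift_none. Qed.

Lemma joinl i : g (phi1 i) = if i == ord0 then ord0 else phi1 (f1 i).
Proof. by rewrite ffunE liftK (unsplitK (inl _ i)). Qed.

Lemma joinr j : g (phi2 j) = if j == ord0 then ord0 else phi2 (f2 j).
Proof. by rewrite ffunE liftK (unsplitK (inr _ j)). Qed.

Variant join_spec : 'I_(N1.+1 + N2.+1).+1 -> Prop :=
  | JoinRoot : join_spec ord0
  | JoinLeft i : join_spec (phi1 i)
  | JoinRight j : join_spec (phi2 j).

Lemma joinP x : join_spec x.
Proof.
case: (unliftP ord0 x) => [y|] ->; last exact: JoinRoot.
by rewrite -(splitK y); case: (split y) => k; [apply: JoinLeft|apply: JoinRight].
Qed.

Lemma phi1_inj : injective phi1.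
Proof. by move=> i j /lift_inj /lshift_inj. Qed.

Lemma phi2_inj : injective phi2.
Proof. by move=> i j /lift_inj /rshift_inj. Qed.

Lemma phi12_neq i j : (phi1 i == phi2 j) = false.
Proof.
by rewrite (inj_eq lift_inj) eq_lrshift.
Qed.

Lemma phi21_neq i j : (phi2 j == phi1 i) = false.
Proof. by rewrite eq_sym phi12_neq. Qed.

Let phiE := (inj_eq phi1_inj, inj_eq phi2_inj, phi12_neq, phi21_neq).

Lemma root_phi1 i : (ord0 == phi1 i) = false.
Proof. exact/negbTE/neq_lift. Qed.

Lemma root_phi2 j : (ord0 == phi2 j) = false.
Proof. exact/negbTE/neq_lift. Qed.

Lemma phi1_root i : (phi1 i == ord0) = false.
Proof. by rewrite eq_sym root_phi1. Qed.

Lemma phi2_root j : (phi2 j == ord0) = false.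
Proof. by rewrite eq_sym root_phi2. Qed.

Lemma join_rooted : is_rooted_tree g.
Proof.
rewrite /is_rooted_tree join0 eqxx; apply/forallP => x.
have it0 k : iter k g ord0 = ord0 by elim: k => //= k ->; exact: join0.
have itl k i : iter k f1 i = ord0 -> iter k.+1 g (phi1 i) = ord0.
  elim: k i => [i /= ->|k IH i]; first by rewrite joinl eqxx.
  rewrite iterSr => /IH h; rewrite iterSr joinl.
  by case: ifP => // _; rewrite it0.
have itr k i : iter k f2 i = ord0 -> iter k.+1 g (phi2 i) = ord0.
  elim: k i => [i /= ->|k IH i]; first by rewrite joinr eqxx.
  rewrite iterSr => /IH h; rewrite iterSr joinr.
  by case: ifP => // _; rewrite it0.
apply/eqP; case: (joinP x) => [|i|j]; first exact: it0.
  by apply: itl; apply: (iter_root tree1); rewrite leq_addr.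
by apply: itr; apply: (iter_root tree2); rewrite leq_addl.
Qed.

Lemma nb_closed_joinl v : nb_closed g (phi1 v) = nb_closed f1 v.
Proof.
move: v; apply: (nb_closed_embed tree1 join_rooted phi1_inj) => v.
apply/setP => c; rewrite inE; apply/idP/imsetP => [|[i]]; last first.
  rewrite inE => /andP[/eqP fi iv] ->; rewrite /child joinl !phiE iv.
  have [i0|_] := eqVneq i ord0; last by rewrite phiE fi eqxx.
  move: iv; rewrite -fi i0.
  by case/andP: tree1 => /eqP ->; rewrite eqxx.
case/andP; case: (joinP c) => [|i|j].
- by rewrite join0 root_phi1.
- rewrite joinl phiE; case: ifP => [_|_]; first by rewrite root_phi1.
  by rewrite phiE => fi iv; exists i; rewrite // inE /child fi.
- by rewrite joinr; case: ifP => [_|_]; rewrite ?root_phi1 ?phiE.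
Qed.

Lemma nb_closed_joinr v : nb_closed g (phi2 v) = nb_closed f2 v.
Proof.
move: v; apply: (nb_closed_embed tree2 join_rooted phi2_inj) => v.
apply/setP => c; rewrite inE; apply/idP/imsetP => [|[i]]; last first.
  rewrite inE => /andP[/eqP fi iv] ->; rewrite /child joinr !phiE iv.
  have [i0|_] := eqVneq i ord0; last by rewrite phiE fi eqxx.
  move: iv; rewrite -fi i0.
  by case/andP: tree2 => /eqP ->; rewrite eqxx.
case/andP; case: (joinP c) => [|i|j].
- by rewrite join0 root_phi2.
- by rewrite joinl; case: ifP => [_|_]; rewrite ?root_phi2 ?phiE.
- rewrite joinr phiE; case: ifP => [_|_]; first by rewrite root_phi2.
  by rewrite phiE => fi iv; exists j; rewrite // inE /child fi.
Qed.

Lemma I_T_join : I_T g + 2 = ((I_T f1 + 2) * (I_T f2 + 2)).-1.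
Proof.
rewrite (I_T_nb_closed join_rooted) (I_T_nb_closed tree1) (I_T_nb_closed tree2).
have hch c : child g ord0 c = (c \in [set phi1 ord0; phi2 ord0]).
  rewrite !inE /child; case: (joinP c) => [|i|j].
  - by rewrite eqxx andbF root_phi1 root_phi2.
  - rewrite joinl !phiE orbF phi1_root andbT.
    by case: (i == ord0); rewrite ?eqxx // phi1_root.
  - rewrite joinr !phiE phi2_root andbT.
    by case: (j == ord0); rewrite ?eqxx // phi2_root.
rewrite (nb_closed_rec join_rooted) !(eq_bigl _ _ hch).
rewrite !big_setU1 /= ?inE ?phiE // !big_set1 nb_closed_joinl nb_closed_joinr.
(* With counts [a] and [b], this is [(a + 1) (b + 1) + a + b + 2 = (a + 2) (b + 2) - 1]. *)
lia.
Qed.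
End Join.

(** * Stars, realised pairs of order and count, and the minimum *)

Definition star (N : nat) : {ffun 'I_N.+1 -> 'I_N.+1} := [ffun _ => ord0].

Lemma star_rooted (N : nat) : is_rooted_tree (star N).
Proof.
by rewrite /is_rooted_tree ffunE eqxx; apply/forallP => x; rewrite iterS ffunE.
Qed.

Lemma I_T_star (N : nat) : I_T (star N) = 2 ^ N + N.
Proof.
have tg := star_rooted N; rewrite (I_T_nb_closed tg).
have leaf v : v != ord0 -> nb_closed (star N) v = 1.
  move=> v0; have hv c : child (star N) v c = false.
    by rewrite /child ffunE eq_sym (negbTE v0).
  by rewrite (nb_closed_rec tg) !(eq_bigl _ _ hv) !big_pred0_eq.
have hch c : child (star N) ord0 c = (c != ord0) by rewrite /child ffunE eqxx.
rewrite (nb_closed_rec tg) !(eq_bigl _ _ hch).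
have cardN : #|[pred c : 'I_N.+1 | c != ord0]| = N by rewrite cardC1 card_ord.
rewrite (eq_bigr (fun=> 2)); last by move=> c /leaf ->.
rewrite [X in _ + X](eq_bigr (fun=> 1)); last by move=> c /leaf ->.
by rewrite prod_nat_const sum_nat_const muln1 cardN.
Qed.

Definition has_tree (n i : nat) : Prop :=
  exists (N : nat) (f : {ffun 'I_N.+1 -> 'I_N.+1}),
    [/\ is_rooted_tree f, n = N.+1 & I_T f = i].

Lemma has_tree_star (N : nat) : has_tree N.+1 (2 ^ N + N).
Proof. by exists N, (star N); rewrite star_rooted I_T_star. Qed.

Lemma has_tree_join (n1 n2 a b c : nat) :
  has_tree n1 a -> has_tree n2 b -> (a + 2) * (b + 2) = c + 3 ->
  has_tree (n1 + n2 + 1) c.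
Proof.
move=> [N1 [f1 [t1 -> <-]]] [N2 [f2 [t2 -> <-]]] hc.
exists _, (join f1 f2); split; first exact: join_rooted.
  by rewrite addn1.
by have := I_T_join t1 t2; lia.
Qed.

Lemma bigminn_le (I : eqType) (r : seq I) (P : pred I) (F : I -> nat) (x : nat) (j : I) :
  j \in r -> P j -> \big[minn/x]_(i <- r | P i) F i <= F j.
Proof.
elim: r => // i r IH; rewrite inE big_cons => /orP[/eqP <- ->|jr Pj].
  exact: geq_minl.
by case: ifP => _; [apply: leq_trans (geq_minr _ _) _|]; apply: IH.
Qed.

Lemma m_le (n i : nat) : has_tree n i -> m_ n <= i.
Proof.
move=> [N [f [tf -> <-]]]; rewrite /m_ /=.
by apply: (bigminn_le _ (P := @is_rooted_tree N)); rewrite ?mem_index_enum.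
Qed.

(** The second premise covers the default value of the big minimum, so no tree attaining the minimum
    has to be exhibited. *)
Lemma m_ind (Q : nat -> nat -> Prop) :
  (forall s : seq (nat * nat), (forall p, p \in s -> Q p.1 p.2) ->
    Q (\prod_(p <- s) p.1.+1 + \sum_(p <- s) p.1) (\sum_(p <- s) p.2).+1) ->
  (forall N, Q (2 ^ N.+1) N.+1) -> forall N, Q (m_ N.+1) N.+1.
Proof.
move=> hQ h2 N; rewrite /m_ /=.
apply: (big_ind (fun i => Q i N.+1)) => //; last by move=> f; apply: I_T_ind.
by move=> i j Qi Qj; case: (leqP i j).
Qed.

End Trees.

(** * The lower bound for branches *)

Module LowerBound.
Import Lra Lia List GrowthConstant.
Open Scope R_scope.

(** * The nested root function [g] as a relation *)

Fixpoint sq_pred_iter (k : nat) (x : R) : R :=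
  match k with O => x | S k => sq_pred_iter k (x * x - 1) end.

(* [g y] is the limit of the nested roots [sqrt (1 + sqrt (1 + ... + y^(2^k)))];
   [dominates x y] says [g y <= x] without mentioning the limit. *)
Definition dominates (x y : R) : Prop :=
  forall k : nat, y ^ (2 ^ k) <= sq_pred_iter k x.

Lemma pow_pow2_S (y : R) (k : nat) : y ^ (2 ^ S k) = (y * y) ^ (2 ^ k).
Proof.
  replace (y * y) with (y ^ 2) by ring.
  rewrite <- pow_mult; reflexivity.
Qed.

Lemma dominates_le (x y : R) : dominates x y -> y <= x.
Proof. intros H; specialize (H O); simpl in H; lra. Qed.

(** Shifting the index by one is the functional equation of [g]. *)
Lemma dominates_sq (x y : R) : dominates x y -> dominates (x * x - 1) (y * y).
Proof. intros H k; specialize (H (S k)); rewrite pow_pow2_S in H; exact H. Qed.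

Lemma dominates_of_sq (x y : R) :
  y <= x -> dominates (x * x - 1) (y * y) -> dominates x y.
Proof.
  intros H0 H [|k]; [simpl; lra|].
  rewrite pow_pow2_S; exact (H k).
Qed.

Lemma dominates_sq_le (x y : R) : dominates x y -> 1 + y * y <= x * x.
Proof. intros H%dominates_sq%dominates_le; lra. Qed.

(** [1 <= y <= x] persists along the iteration and keeps it in the range where squaring is
    increasing. *)
Lemma dominates_mono (x x' y : R) :
  1 <= y -> x <= x' -> dominates x y -> dominates x' y.
Proof.
  intros Hy Hx H k; revert x x' y Hy Hx H.
  induction k as [|k IH]; intros x x' y Hy Hx H.
  - pose proof (dominates_le _ _ H); simpl; lra.
  - pose proof (dominates_le _ _ H); rewrite pow_pow2_S; simpl.
    apply IH with (x * x - 1); [nra|nra|apply dominates_sq, H].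
Qed.

(** One step preserves the condition: [(y + 1/y)^2 - 1 = y^2 + 1 + 1/y^2] exceeds [y^2 + 1/y^2]. *)
Lemma dominates_of_le (x y : R) : 1 <= y -> y + / y <= x -> dominates x y.
Proof.
  intros Hy Hx k; revert x y Hy Hx.
  induction k as [|k IH]; intros x y Hy Hx.
  - assert (0 < / y) by (apply Rinv_0_lt_compat; lra); simpl; lra.
  - rewrite pow_pow2_S; simpl; apply IH; [nra|].
    assert (0 < / y) by (apply Rinv_0_lt_compat; lra).
    assert (y * / y = 1) by (field; lra).
    rewrite Rinv_mult; nra.
Qed.

(** Trading [/ y] for a constant leaves goals within reach of linear arithmetic. *)
Lemma dominates_of_bounds (x y c : R) :
  1 <= c -> c <= y -> y + / c <= x -> dominates x y.
Proof.
  intros Hc Hy Hx; apply dominates_of_le; [lra|].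
  assert (/ y <= / c) by (apply Rinv_le_contravar; lra); lra.
Qed.

(** The iterates of 13 are the [x_k]. No decimal bound on [alpha] would do here, since the ratios of
    the two sides tend to 1. *)
Lemma dominates_13 : dominates 13 (alpha ^ 5).
Proof.
  intros k; rewrite <- pow_mult.
  replace (sq_pred_iter k 13) with (xseq (S k)); [apply alpha_pow_bounds|].
  assert (H : forall k j, xseq (S (j + k)) = sq_pred_iter k (xseq (S j))).
  { clear k; induction k as [|k IH]; intros j; [rewrite Nat.add_0_r; reflexivity|].
    change (sq_pred_iter (S k) (xseq (S j))) with (sq_pred_iter k (xseq (S (S j)))).
    rewrite <- IH, Nat.add_succ_r; reflexivity. }
  exact (H k O).
Qed.

(** * Values of branches, and trees with at most two branches *)

Lemma alpha_pow_between (n : nat) :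
  (166928 / 100000) ^ n <= alpha ^ n <= (166929 / 100000) ^ n.
Proof. pose proof alpha_bounds; split; apply pow_incr; lra. Qed.

Lemma alpha_pow_ge (m n : nat) :
  (m <= n)%nat -> (166928 / 100000) ^ m <= alpha ^ n.
Proof.
  intros H; pose proof alpha_bounds.
  eapply Rle_trans; [apply alpha_pow_between|apply Rle_pow; [lra|exact H]].
Qed.

Lemma alpha_pow_ge1 (n : nat) : 1 <= alpha ^ n.
Proof. exact (alpha_pow_ge 0 n (Nat.le_0_l n)). Qed.

(* [x] stands for [I(T) + 2] and [n] for the order of a branch [T]. *)
Definition branch_bound (x : R) (n : nat) : Prop :=
  dominates x (alpha ^ (n + 1)) /\
  (n = 1%nat /\ 3 <= x \/ n = 2%nat /\ 5 <= x \/ (3 <= n)%nat /\ 8 <= x).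

Lemma branch_bound_ge3 (x : R) (n : nat) : branch_bound x n -> 3 <= x /\ (1 <= n)%nat.
Proof. intros [_ H]; split; [|lia]; lra. Qed.

(** [dominates] forces [i > 0], [i > 2] and [i > 5] for orders 1, 2 and at least 3; integrality then
    gives 3, 5 and 8 for [i + 2]. *)
Lemma branch_bound_integer (i n : nat) :
  (1 <= n)%nat -> dominates (INR i + 2) (alpha ^ (n + 1)) ->
  branch_bound (INR i + 2) n.
Proof.
  intros Hn H; split; [exact H|].
  pose proof (dominates_le _ _ H) as H1; pose proof (dominates_sq_le _ _ H) as H2.
  pose proof (pos_INR i) as Hi.
  assert (Hint : forall m, INR m < INR i -> INR (S m) <= INR i).
  { intros m Hm; apply le_INR, INR_lt, Hm. }
  destruct n as [|[|[|n]]]; [lia| | |].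
  - left; split; [reflexivity|].
    pose proof (alpha_pow_ge 2 (1 + 1) (le_n _)).
    specialize (Hint 0%nat); simpl (INR _) in Hint; nra.
  - right; left; split; [reflexivity|].
    pose proof (alpha_pow_ge 3 (2 + 1) (le_n _)).
    assert (INR 2 < INR i) by (simpl (INR 2); nra).
    specialize (Hint 2%nat); simpl (INR 2) in *; simpl (INR 3) in *; lra.
  - right; right; split; [lia|].
    pose proof (alpha_pow_ge 4 (S (S (S n)) + 1) ltac:(lia)).
    assert (INR 5 < INR i) by (simpl (INR 5); lra).
    specialize (Hint 5%nat); simpl (INR 5) in *; simpl (INR 6) in *; lra.
Qed.

(** In terms of [x = I + 2], the factor [1 + I] of the recursion is [x - 1] and the summand [I] is
    [x - 2]. *)
Fixpoint prod_pred (l : list (R * nat)) : R :=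
  match l with nil => 1 | p :: l => (fst p - 1) * prod_pred l end.

Fixpoint sum_pred2 (l : list (R * nat)) : R :=
  match l with nil => 0 | p :: l => (fst p - 2) + sum_pred2 l end.

Fixpoint total_order (l : list (R * nat)) : nat :=
  match l with nil => O | p :: l => (snd p + total_order l)%nat end.

(** Here [y + 1/y] is about 3.145 and too large, so one squaring step comes first; it leaves 8
    against [alpha ^ 4], about 7.765. *)
Lemma dominates_no_branch : dominates 3 (alpha ^ 2).
Proof.
  pose proof (alpha_pow_between 2); pose proof (alpha_pow_between 4).
  apply dominates_of_sq; [lra|].
  replace (alpha ^ 2 * alpha ^ 2) with (alpha ^ 4) by ring.
  apply dominates_of_bounds with 7; lra.
Qed.

Lemma dominates_one_branch (x : R) (n : nat) :
  branch_bound x n -> dominates (2 * x - 1) (alpha ^ (n + 2)).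
Proof.
  intros [H Hn]; pose proof (dominates_le _ _ H) as H1; pose proof alpha_bounds.
  (* Replacing [alpha ^ (n + 1)] by [x] leaves a slack [(2 - alpha) x - 1], which is negative at
     [x = 3]; a leaf is therefore compared with [alpha ^ 3] directly. *)
  destruct Hn as [[-> Hx]|Hn].
  - pose proof (alpha_pow_between 3); simpl (1 + 2)%nat.
    apply dominates_of_bounds with 4; lra.
  - assert (2 <= n)%nat by lia.
    replace (n + 2)%nat with (S (n + 1)) by lia; simpl (alpha ^ S _).
    pose proof (alpha_pow_ge 3 (n + 1) ltac:(lia)).
    apply dominates_of_bounds with 4; [lra|nra|].
    assert (5 <= x) by lra; nra.
Qed.

(** [(1 + y^2) (1 + z^2) = (y z + 1)^2 + (z - y)^2]. With [u = 1/(y z)] the squared goal needs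
    [(z - y)^2 >= 2 + 2 u + u^2], which is below 2.2, while the separation of [y] and [z] gives
    3.45. *)
Lemma distinct_product_bound (x y w z : R) :
  0 < x -> 0 < w -> 278 / 100 <= y -> 166928 / 100000 * y <= z ->
  1 + y * y <= x * x -> 1 + z * z <= w * w -> y * z + / (y * z) <= x * w - 1.
Proof.
  intros Hx Hw Hy Hz Hxy Hwz.
  assert (Ht : 1289 / 100 <= y * z) by nra.
  assert (Hu : 0 < / (y * z) <= / (1289 / 100)).
  { split; [apply Rinv_0_lt_compat; lra|apply Rinv_le_contravar; lra]. }
  assert (Htu : y * z * / (y * z) = 1) by (field; split; nra).
  set (u := / (y * z)) in *.
  assert (Hsq : (y * z + 1 + u) * (y * z + 1 + u) <= (x * w) * (x * w)).
  { assert (Hp : (1 + y * y) * (1 + z * z) <= (x * x) * (w * w))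
      by (apply Rmult_le_compat; nra).
    assert (Hd : 345 / 100 <= (z - y) * (z - y)) by nra.
    nra. }
  assert (0 < x * w) by nra.
  nra.
Qed.

Lemma dominates_two_branches_lt (x1 x2 : R) (n1 n2 : nat) : (n1 < n2)%nat ->
  branch_bound x1 n1 -> branch_bound x2 n2 ->
  dominates (x1 * x2 - 1) (alpha ^ (n1 + n2 + 2)).
Proof.
  intros Hlt B1 B2.
  destruct (branch_bound_ge3 _ _ B1) as [Hx1 Hn1].
  destruct (branch_bound_ge3 _ _ B2) as [Hx2 _].
  destruct B1 as [D1 _], B2 as [D2 _]; pose proof alpha_bounds.
  replace (n1 + n2 + 2)%nat with ((n1 + 1) + (n2 + 1))%nat by lia.
  rewrite pow_add.
  assert (Hy : 278 / 100 <= alpha ^ (n1 + 1)).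
  { pose proof (alpha_pow_ge 2 (n1 + 1) ltac:(lia)); lra. }
  assert (Hz : 166928 / 100000 * alpha ^ (n1 + 1) <= alpha ^ (n2 + 1)).
  { apply Rle_trans with (alpha ^ S (n1 + 1)); [simpl; nra|].
    apply Rle_pow; [lra|lia]. }
  apply dominates_of_le; [nra|].
  apply distinct_product_bound; try lra; apply dominates_sq_le; assumption.
Qed.

Lemma dominates_two_branches (x1 x2 : R) (n1 n2 : nat) :
  branch_bound x1 n1 -> branch_bound x2 n2 ->
  dominates (x1 * x2 - 1) (alpha ^ (n1 + n2 + 2)).
Proof.
  intros B1 B2.
  destruct (Nat.lt_trichotomy n1 n2) as [Hlt|[Heq|Hlt]].
  - apply dominates_two_branches_lt; assumption.
  (* For equal orders both values dominate the same [y], and squaring the smaller one is the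
     functional equation. *)
  - subst n2; destruct (branch_bound_ge3 _ _ B1), (branch_bound_ge3 _ _ B2).
    destruct B1 as [D1 _], B2 as [D2 _].
    replace (n1 + n1 + 2)%nat with ((n1 + 1) + (n1 + 1))%nat by lia.
    rewrite pow_add; pose proof (alpha_pow_ge1 (n1 + 1)).
    destruct (Rle_dec x1 x2).
    + apply dominates_mono with (x1 * x1 - 1); [nra|nra|apply dominates_sq, D1].
    + apply dominates_mono with (x2 * x2 - 1); [nra|nra|apply dominates_sq, D2].
  - rewrite Rmult_comm, (Nat.add_comm n1 n2).
    apply dominates_two_branches_lt; assumption.
Qed.

(** * Three or more branches *)

Definition three_branches (x1 x2 x3 : R) : R :=
  (x1 - 1) * (x2 - 1) * (x3 - 1) + x1 + x2 + x3 - 4.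

(** The exponents [n_i + 1] add up to one more than the target exponent. Without leaves this spare
    factor [alpha] pays for passing from the [x_i] to the [x_i - 1]; configurations with leaves are
    treated separately. *)
Lemma dominates_three_branches_sorted (x1 x2 x3 : R) (n1 n2 n3 : nat) :
  (n1 <= n2)%nat -> (n2 <= n3)%nat ->
  branch_bound x1 n1 -> branch_bound x2 n2 -> branch_bound x3 n3 ->
  dominates (three_branches x1 x2 x3) (alpha ^ (n1 + n2 + n3 + 2)).
Proof.
  intros H12 H23 B1 B2 B3.
  destruct (branch_bound_ge3 _ _ B1) as [Hx1 Hn1].
  destruct (branch_bound_ge3 _ _ B2) as [Hx2 Hn2].
  destruct (branch_bound_ge3 _ _ B3) as [Hx3 Hn3].
  destruct B1 as [D1 C1], B2 as [D2 C2], B3 as [D3 C3].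
  apply dominates_le in D1, D2, D3.
  pose proof alpha_bounds as Ha.
  assert (Hmono : forall a, 3 <= a -> a <= x1 ->
    three_branches a x2 x3 <= three_branches x1 x2 x3).
  { intros a Ha3 Hax; unfold three_branches.
    assert (0 <= (x2 - 3) * (x3 - 3)) by (apply Rmult_le_pos; lra).
    assert (0 <= (x1 - a) * ((x2 - 1) * (x3 - 1) + 1)) by (apply Rmult_le_pos; lra).
    lra. }
  destruct C1 as [[-> _]|C1].
  - assert (Hleaf : 2 * (x2 * x3) - x2 - x3 + 1 <= three_branches x1 x2 x3).
    { eapply Rle_trans; [|apply (Hmono 3); lra]; unfold three_branches; nra. }
    destruct C2 as [[-> _]|C2].
    + assert (Hleaf2 : 5 * x3 - 2 <= three_branches x1 x2 x3) by nra.
      destruct C3 as [[-> _]|[[-> Hx]|[Hn Hx]]].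
      (* Three leaves form the star of order 4, where the bound is tight. *)
      * apply dominates_mono with 13; [apply alpha_pow_ge1|lra|].
        exact dominates_13.
      * pose proof (alpha_pow_between 6); simpl (1 + 1 + 2 + 2)%nat.
        apply dominates_of_bounds with 20; lra.
      * replace (1 + 1 + n3 + 2)%nat with (3 + (n3 + 1))%nat by lia.
        pose proof (alpha_pow_between 3); pose proof (alpha_pow_ge 4 (n3 + 1) ltac:(lia)).
        rewrite pow_add; apply dominates_of_bounds with 20; [lra|nra|].
        nra.
    + destruct (Nat.eq_dec n3 2) as [->|Hn3'].
      * assert (n2 = 2%nat) as -> by lia.
        pose proof (alpha_pow_between 7); simpl (1 + 2 + 2 + 2)%nat.
        assert (5 <= x2) by lra.
        assert (5 <= x3) by (destruct C3 as [[? _]|[?|?]]; [discriminate|lra|lra]).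
        assert (0 <= (x2 - 5) * (x3 - 5)) by (apply Rmult_le_pos; lra).
        apply dominates_of_bounds with 30; lra.
      * assert (5 <= x2) by lra.
        assert (8 <= x3) by (destruct C3 as [[? _]|[[? _]|?]]; [lia|lia|lra]).
        replace (1 + n2 + n3 + 2)%nat with (S ((n2 + 1) + (n3 + 1)))%nat by lia.
        pose proof (alpha_pow_ge 3 (n2 + 1) ltac:(lia)).
        pose proof (alpha_pow_ge 4 (n3 + 1) ltac:(lia)).
        simpl (alpha ^ S _); rewrite pow_add.
        assert (Hyz : 36 <= alpha ^ (n2 + 1) * alpha ^ (n3 + 1) <= x2 * x3).
        { split; [|apply Rmult_le_compat; lra].
          apply Rle_trans with (465 / 100 * (776 / 100)); [lra|].
          apply Rmult_le_compat; lra. }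
        assert (1 * (alpha ^ (n2 + 1) * alpha ^ (n3 + 1)) <=
                alpha * (alpha ^ (n2 + 1) * alpha ^ (n3 + 1)))
          by (apply Rmult_le_compat_r; lra).
        assert (alpha * (alpha ^ (n2 + 1) * alpha ^ (n3 + 1)) <= 166929 / 100000 * (x2 * x3))
          by (apply Rmult_le_compat; lra).
        assert (0 <= (x2 - 5) * (x3 - 8)) by (apply Rmult_le_pos; lra).
        apply dominates_of_bounds with 36; lra.
  - assert (5 <= x1) by lra.
    assert (5 <= x2) by (destruct C1, C2 as [?|?]; lia || lra).
    assert (5 <= x3) by (destruct C1, C3 as [?|?]; lia || lra).
    pose proof (alpha_pow_ge 8 (n1 + n2 + n3 + 2) ltac:(lia)) as H8.
    apply dominates_of_bounds with 60; [lra|lra|].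
    assert (Hy : alpha ^ (n1 + n2 + n3 + 2) * alpha <= x1 * x2 * x3).
    { replace (alpha ^ (n1 + n2 + n3 + 2) * alpha) with
        (alpha ^ (n1 + 1) * alpha ^ (n2 + 1) * alpha ^ (n3 + 1)).
      2:{ rewrite <- !pow_add, Rmult_comm, tech_pow_Rmult; f_equal; lia. }
      pose proof (alpha_pow_ge1 (n1 + 1)); pose proof (alpha_pow_ge1 (n2 + 1)).
      pose proof (alpha_pow_ge1 (n3 + 1)).
      apply Rmult_le_compat; [nra|lra| |lra]; apply Rmult_le_compat; lra. }
    (* [0.59907] is an upper bound for [1 / alpha]. *)
    assert (Hy' : alpha ^ (n1 + n2 + n3 + 2) <= 59907 / 100000 * (x1 * x2 * x3)).
    { assert (alpha ^ (n1 + n2 + n3 + 2) * (166928 / 100000) <=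
              alpha ^ (n1 + n2 + n3 + 2) * alpha) by (apply Rmult_le_compat_l; lra).
      lra. }
    eapply Rle_trans; [apply Rplus_le_compat_r, Hy'|].
    unfold three_branches.
    (* Around [(5, 5, 5)], where the claim reads about [74.9 <= 75], the difference of the two sides
       expands with nonnegative coefficients. *)
    replace x1 with (5 + (x1 - 5)) by ring; replace x2 with (5 + (x2 - 5)) by ring.
    replace x3 with (5 + (x3 - 5)) by ring.
    assert (0 <= x1 - 5) by lra; assert (0 <= x2 - 5) by lra; assert (0 <= x3 - 5) by lra.
    generalize dependent (x1 - 5); intros s; generalize dependent (x2 - 5); intros t.
    generalize dependent (x3 - 5); intros r; intros.
    assert (0 <= s * t) by (apply Rmult_le_pos; lra).
    assert (0 <= s * r) by (apply Rmult_le_pos; lra).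
    assert (0 <= t * r) by (apply Rmult_le_pos; lra).
    assert (0 <= s * t * r) by (apply Rmult_le_pos; lra).
    lra.
Qed.
Lemma dominates_three_branches (x1 x2 x3 : R) (n1 n2 n3 : nat) :
  branch_bound x1 n1 -> branch_bound x2 n2 -> branch_bound x3 n3 ->
  dominates (three_branches x1 x2 x3) (alpha ^ (n1 + n2 + n3 + 2)).
Proof.
  intros B1 B2 B3.
  assert (H : forall x1 x2 x3 n1 n2 n3, (n1 <= n2)%nat ->
    branch_bound x1 n1 -> branch_bound x2 n2 -> branch_bound x3 n3 ->
    dominates (three_branches x1 x2 x3) (alpha ^ (n1 + n2 + n3 + 2))).
  { clear; intros x1 x2 x3 n1 n2 n3 H12 B1 B2 B3.
    destruct (Nat.le_gt_cases n2 n3).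
    { apply dominates_three_branches_sorted; assumption. }
    destruct (Nat.le_gt_cases n1 n3).
    - replace (n1 + n2 + n3)%nat with (n1 + n3 + n2)%nat by lia.
      replace (three_branches x1 x2 x3) with (three_branches x1 x3 x2)
        by (unfold three_branches; ring).
      apply dominates_three_branches_sorted; [lia|lia|assumption..].
    - replace (n1 + n2 + n3)%nat with (n3 + n1 + n2)%nat by lia.
      replace (three_branches x1 x2 x3) with (three_branches x3 x1 x2)
        by (unfold three_branches; ring).
      apply dominates_three_branches_sorted; [lia|lia|assumption..]. }
  destruct (Nat.le_gt_cases n1 n2); [apply H; assumption|].
  replace (n1 + n2 + n3)%nat with (n2 + n1 + n3)%nat by lia.
  replace (three_branches x1 x2 x3) with (three_branches x2 x1 x3)
    by (unfold three_branches; ring).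
  apply H; [lia|assumption..].
Qed.

Lemma sum_pred2_nonneg (l : list (R * nat)) :
  (forall p, In p l -> branch_bound (fst p) (snd p)) -> 0 <= sum_pred2 l.
Proof.
  induction l as [|[x n] l IH]; intros H; simpl; [lra|].
  pose proof (branch_bound_ge3 _ _ (H (x, n) (or_introl eq_refl))).
  assert (0 <= sum_pred2 l) by (apply IH; intros p Hp; apply H; right; exact Hp).
  simpl in *; lra.
Qed.

(** Three leaves give product 8 and sum 3, hence [7.6 <= 8]. A further branch multiplies the product
    by [x - 1] but adds only [x - 2] to the sum. The constants are those wanted by
    [dominates_add_branch]. *)
Lemma prod_pred_bound (x1 x2 x3 : R) (n1 n2 n3 : nat) (l : list (R * nat)) :
  (forall p, In p ((x1, n1) :: (x2, n2) :: (x3, n3) :: l) ->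
     branch_bound (fst p) (snd p)) ->
  3 <= sum_pred2 ((x1, n1) :: (x2, n2) :: (x3, n3) :: l) /\
  21 / 10 * sum_pred2 ((x1, n1) :: (x2, n2) :: (x3, n3) :: l) + 13 / 10 <=
    prod_pred ((x1, n1) :: (x2, n2) :: (x3, n3) :: l).
Proof.
  intros H; simpl.
  pose proof (branch_bound_ge3 _ _ (H (x1, n1) ltac:(simpl; auto))) as [H1 _].
  pose proof (branch_bound_ge3 _ _ (H (x2, n2) ltac:(simpl; auto))) as [H2 _].
  pose proof (branch_bound_ge3 _ _ (H (x3, n3) ltac:(simpl; auto))) as [H3 _].
  assert (Hl : forall p, In p l -> branch_bound (fst p) (snd p))
    by (intros p Hp; apply H; simpl; auto).
  pose proof (sum_pred2_nonneg l Hl) as Hs; simpl in *; split; [lra|].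
  clear H; induction l as [|[x n] l IH]; simpl in *.
  - assert (0 <= (x1 - 3) * (x2 - 3)) by (apply Rmult_le_pos; lra).
    assert (0 <= (x1 - 3) * (x3 - 3)) by (apply Rmult_le_pos; lra).
    assert (0 <= (x2 - 3) * (x3 - 3)) by (apply Rmult_le_pos; lra).
    assert (0 <= (x1 - 3) * (x2 - 3) * (x3 - 3)) by (apply Rmult_le_pos; lra).
    lra.
  - assert (Hl' : forall p, In p l -> branch_bound (fst p) (snd p))
      by (intros p Hp; apply Hl; auto).
    pose proof (sum_pred2_nonneg l Hl') as Hs'; specialize (IH Hl' Hs').
    pose proof (branch_bound_ge3 _ _ (Hl (x, n) (or_introl eq_refl))) as [Hx _].
    simpl in Hx.
    replace ((x1 - 1) * ((x2 - 1) * ((x3 - 1) * ((x - 1) * prod_pred l)))) with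
      ((x - 1) * ((x1 - 1) * ((x2 - 1) * ((x3 - 1) * prod_pred l)))) by ring.
    set (P := (x1 - 1) * ((x2 - 1) * ((x3 - 1) * prod_pred l))) in *.
    assert (0 <= (x - 3) * (P - 21 / 10)) by (apply Rmult_le_pos; lra).
    lra.
Qed.

(** [F] is the value of the tree without the branch [x], and the formula is its value with it. The
    target grows by [alpha ^ n], the main term by [x - 1]; the surplus [0.33 (x - 2) F] outweighs
    the correction [(x - 2) (S' + 1)]. *)
Lemma dominates_add_branch (x F S' : R) (n m : nat) :
  branch_bound x n -> (3 <= m)%nat -> dominates F (alpha ^ (m + 2)) ->
  3 <= S' -> S' + 2 + (21 / 10 * S' + 13 / 10) <= F ->
  dominates ((x - 1) * F - (x - 2) * (S' + 1)) (alpha ^ (n + m + 2)).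
Proof.
  intros [D C] Hm DF HS HF.
  pose proof (dominates_le _ _ D) as Hy; apply dominates_le in DF.
  pose proof alpha_bounds; pose proof (alpha_pow_ge1 (m + 2)).
  assert (Hn : (1 <= n)%nat) by lia; assert (Hx : 3 <= x) by lra.
  apply dominates_of_bounds with 20; [lra| |].
  { pose proof (alpha_pow_ge 6 (n + m + 2) ltac:(lia)); lra. }
  (* The constant comes from a leaf with [x = 3], where the gap is [2 - alpha]. *)
  assert (Hgap : 33 / 100 * (x - 2) <= x - 1 - alpha ^ n).
  { destruct C as [[-> C]|[[-> C]|[C1 C2]]].
    - simpl; lra.
    - pose proof (alpha_pow_between 2); lra.
    - rewrite Nat.add_1_r in Hy; simpl in Hy.
      assert (166928 / 100000 * alpha ^ n <= alpha * alpha ^ n).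
      { apply Rmult_le_compat_r; [pose proof (alpha_pow_ge1 n)|]; lra. }
      lra. }
  replace (n + m + 2)%nat with (n + (m + 2))%nat by lia; rewrite pow_add.
  assert (alpha ^ n * alpha ^ (m + 2) <= alpha ^ n * F).
  { apply Rmult_le_compat_l; [pose proof (alpha_pow_ge1 n)|]; lra. }
  assert (0 <= (x - 1 - alpha ^ n - 33 / 100 * (x - 2)) * F)
    by (apply Rmult_le_pos; lra).
  assert (0 <= (x - 2 - 1) * (33 / 100 * F - S' - 1 - 1 / 20))
    by (apply Rmult_le_pos; lra).
  lra.
Qed.

Lemma dominates_many_branches (x1 x2 x3 : R) (n1 n2 n3 : nat) (l : list (R * nat)) :
  (forall p, In p ((x1, n1) :: (x2, n2) :: (x3, n3) :: l) ->
     branch_bound (fst p) (snd p)) ->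
  let l' := (x1, n1) :: (x2, n2) :: (x3, n3) :: l in
  dominates (prod_pred l' + sum_pred2 l' + 2) (alpha ^ (total_order l' + 2)).
Proof.
  induction l as [|[x n] l IH]; intros H l'.
  - replace (prod_pred l' + sum_pred2 l' + 2) with (three_branches x1 x2 x3)
      by (unfold three_branches; simpl; ring).
    replace (total_order l') with (n1 + n2 + n3)%nat by (simpl; lia).
    apply dominates_three_branches.
    + exact (H (x1, n1) ltac:(simpl; auto)).
    + exact (H (x2, n2) ltac:(simpl; auto)).
    + exact (H (x3, n3) ltac:(simpl; auto)).
  - set (l0 := (x1, n1) :: (x2, n2) :: (x3, n3) :: l) in *.
    assert (H0 : forall p, In p l0 -> branch_bound (fst p) (snd p)).
    { intros p Hp; apply H; simpl in *; tauto. }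
    destruct (prod_pred_bound _ _ _ _ _ _ _ H0) as [HS HP].
    specialize (IH H0); fold l0 in HS, HP; cbv zeta in IH.
    replace (prod_pred l' + sum_pred2 l' + 2) with
      ((x - 1) * (prod_pred l0 + sum_pred2 l0 + 2) - (x - 2) * (sum_pred2 l0 + 1))
      by (simpl; ring).
    replace (total_order l') with (n + total_order l0)%nat by (simpl; lia).
    apply dominates_add_branch; [| |exact IH|exact HS|lra].
    + exact (H (x, n) ltac:(simpl; auto)).
    + pose proof (branch_bound_ge3 _ _ (H0 (x1, n1) ltac:(simpl; auto))) as [_ ?].
      pose proof (branch_bound_ge3 _ _ (H0 (x2, n2) ltac:(simpl; auto))) as [_ ?].
      pose proof (branch_bound_ge3 _ _ (H0 (x3, n3) ltac:(simpl; auto))) as [_ ?].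
      simpl in *; lia.
Qed.

Lemma dominates_branches (l : list (R * nat)) :
  (forall p, In p l -> branch_bound (fst p) (snd p)) ->
  dominates (prod_pred l + sum_pred2 l + 2) (alpha ^ (total_order l + 2)).
Proof.
  destruct l as [|[x1 n1] [|[x2 n2] [|[x3 n3] l]]]; intros H.
  - simpl total_order; simpl prod_pred; simpl sum_pred2.
    replace (1 + 0 + 2) with 3 by ring; exact dominates_no_branch.
  - simpl; rewrite Nat.add_0_r.
    replace ((x1 - 1) * 1 + (x1 - 2 + 0) + 2) with (2 * x1 - 1) by ring.
    apply dominates_one_branch; exact (H (x1, n1) (or_introl eq_refl)).
  - simpl; rewrite Nat.add_0_r.
    replace ((x1 - 1) * ((x2 - 1) * 1) + (x1 - 2 + (x2 - 2 + 0)) + 2)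
      with (x1 * x2 - 1) by ring.
    apply dominates_two_branches.
    + exact (H (x1, n1) ltac:(simpl; auto)).
    + exact (H (x2, n2) ltac:(simpl; auto)).
  - apply dominates_many_branches; exact H.
Qed.

(** This serves the default value in [m_]. For large exponents it reduces to [alpha ^ 5 <= 13 < 16]
    and [alpha <= 2]. *)
Lemma dominates_pow2 (N : nat) : dominates (INR (2 ^ S N) + 2) (alpha ^ (S N + 1)).
Proof.
  rewrite pow_INR; replace (INR 2) with 2 by (simpl; ring).
  pose proof alpha_bounds.
  destruct N as [|[|[|N]]].
  - pose proof (alpha_pow_between 2); simpl (_ + 1)%nat.
    apply dominates_of_bounds with 2; lra.
  - pose proof (alpha_pow_between 3); simpl (_ + 1)%nat.
    apply dominates_of_bounds with 2; lra.
  - pose proof (alpha_pow_between 4); simpl (_ + 1)%nat.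
    apply dominates_of_bounds with 2; lra.
  - replace (S (S (S (S N))) + 1)%nat with (5 + N)%nat by lia.
    replace (S (S (S (S N)))) with (4 + N)%nat by lia.
    apply dominates_of_bounds with 2; [lra| |].
    + pose proof (alpha_pow_ge 5 (5 + N) ltac:(lia)); lra.
    + rewrite !pow_add; pose proof (alpha_pow_between 5).
      assert (alpha ^ N <= 2 ^ N) by (apply pow_incr; lra).
      assert (alpha ^ 5 * alpha ^ N <= 13 * 2 ^ N).
      { pose proof (alpha_pow_ge1 N); apply Rmult_le_compat; lra. }
      pose proof (alpha_pow_ge1 N); lra.
Qed.

End LowerBound.

(** * Trees of small I(T), and the two bounds *)

Module Extremal.
Import Lra Lia GrowthConstant LowerBound Trees.
Open Scope R_scope.

(** * Transfer from natural numbers to reals *)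

Module Transfer.
Import all_boot.

Lemma In_mem (s : seq (nat * nat)) (p : nat * nat) : List.In p s -> p \in s.
Proof.
elim: s => //= q s IH [->|/IH ps]; by rewrite inE ?eqxx // ps orbT.
Qed.

Definition branches (s : seq (nat * nat)) : list (R * nat) :=
  [seq (INR p.1 + 2, p.2) | p <- s].

Lemma INR_node (s : seq (nat * nat)) :
  INR (\prod_(p <- s) p.1.+1 + \sum_(p <- s) p.1)%N =
  prod_pred (branches s) + sum_pred2 (branches s).
Proof.
suff [hp hs] : INR (\prod_(p <- s) p.1.+1)%N = prod_pred (branches s) /\
    INR (\sum_(p <- s) p.1)%N = sum_pred2 (branches s).
  by rewrite -hp -hs; apply: plus_INR.
elim: s => [|p s [hp hs]]; first by rewrite !big_nil.
rewrite !big_cons /= -hp -hs; split.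
  transitivity (INR p.1.+1 * INR (\prod_(q <- s) q.1.+1)%N); first exact: mult_INR.
  by rewrite S_INR; congr (_ * _); ring.
transitivity (INR p.1 + INR (\sum_(q <- s) q.1)%N); first exact: plus_INR.
by ring.
Qed.

Lemma total_order_branches (s : seq (nat * nat)) :
  total_order (branches s) = (\sum_(p <- s) p.2)%N.
Proof. by elim: s => [|p s IH]; rewrite ?big_nil // big_cons /= IH. Qed.

Lemma m_dominates (N : nat) : dominates (INR (m_ N.+1) + 2) (alpha ^ (N.+1 + 1)%coq_nat).
Proof.
(* Positivity of the order joins the induction claim because [branch_bound_integer] asks for it at
   each branch. *)
suff [] : (1 <= N.+1)%coq_nat /\ dominates (INR (m_ N.+1) + 2) (alpha ^ (N.+1 + 1)%coq_nat) by [].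
apply: (m_ind (Q := fun i n => (1 <= n)%coq_nat /\
  dominates (INR i + 2) (alpha ^ (n + 1)%coq_nat))) => [s hs|M].
  split; first exact: le_n_S (Nat.le_0_l _).
  have := @dominates_branches (branches s) _.
  rewrite INR_node total_order_branches.
  set n := (\sum_(p <- s) p.2)%N.
  have -> : (n + 2 = n.+1 + 1)%coq_nat by rewrite -!plus_n_Sm -!plus_n_O.
  apply=> p /List.in_map_iff[q [<- qs]].
  by have [q1 qd] := hs q (In_mem _ _ qs); apply: branch_bound_integer.
split; first exact: le_n_S (Nat.le_0_l _).
have -> : (2 ^ M.+1)%N = Nat.pow 2 M.+1.
  by elim: M.+1 => // k IH; rewrite expnS IH /=; lia.
exact: dominates_pow2.
Qed.

Lemma m_le_nat (n i : nat) : has_tree n i -> (m_ n <= i)%coq_nat.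
Proof. by move=> h; apply/leP/m_le. Qed.

Lemma has_tree_join_R (n1 n2 a b : nat) : has_tree n1 a -> has_tree n2 b ->
  exists c, has_tree (n1 + n2 + 1)%coq_nat c /\
    INR c + 2 = (INR a + 2) * (INR b + 2) - 1.
Proof.
move=> h1 h2; exists ((a + 2) * (b + 2) - 3)%coq_nat.
(* This makes the truncated subtraction exact. *)
have le3 : (3 <= (a + 2) * (b + 2))%coq_nat by nia.
split; last by rewrite minus_INR // mult_INR !plus_INR /=; ring.
apply: (has_tree_join h1 h2).
change (((a + 2) * (b + 2)) = ((a + 2) * (b + 2) - 3) + 3)%coq_nat; lia.
Qed.

(** Joins of stars of orders 1, 4 and 5 give one seed for each residue of the order modulo 5; the
    star of order 4 starts the doubling. *)
Lemma has_tree_small :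
  [/\ has_tree 8 101, has_tree 9 166, has_tree 10 283, has_tree 11 481 &
    has_tree 12 816] /\ has_tree 4 11.
Proof.
have t1 := has_tree_star 0; have t4 := has_tree_star 3.
have t5 := has_tree_star 4.
have t3 : has_tree 3 6 by apply: (has_tree_join t1 t1).
have t7 : has_tree 7 61 by apply: (has_tree_join t3 t3).
by split=> //; split; [apply: (has_tree_join t3 t4)|apply: (has_tree_join t4 t4)
  |apply: (has_tree_join t4 t5)|apply: (has_tree_join t5 t5)
  |apply: (has_tree_join t7 t4)].
Qed.
End Transfer.
Import Transfer.

(** * Extremal trees and the loss in joining them *)

Lemma has_tree_xseq (k : nat) :
  exists i, has_tree (5 * 2 ^ k - 1) i /\ INR i + 2 = xseq (S k).
Proof.
  induction k as [|k [i [H Hi]]].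
  - exists 11%nat; split; [apply has_tree_small|simpl; ring].
  - destruct (has_tree_join_R _ _ _ _ H H) as [c [Hc Hci]].
    pose proof (Nat.pow_nonzero 2 k ltac:(lia)).
    exists c; split; [|rewrite Hci, Hi, xseq_rec; reflexivity].
    replace (5 * 2 ^ S k - 1)%nat with (5 * 2 ^ k - 1 + (5 * 2 ^ k - 1) + 1)%nat;
      [exact Hc|simpl; lia].
Qed.

Definition ratio (k : nat) : R := xseq (S k) / alpha ^ (5 * 2 ^ k).

(** The worst loss for [k] binary digits, when all of them are one. *)
Fixpoint ratio_prod (k : nat) : R :=
  match k with O => 1 | S k => ratio_prod k * ratio k end.

Lemma ratio_ge1 (k : nat) : 1 <= ratio k.
Proof.
  destruct (alpha_pow_bounds k) as [_ H]; pose proof (alpha_pow_ge1 (5 * 2 ^ k)).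
  apply Rmult_le_reg_r with (alpha ^ (5 * 2 ^ k)); [lra|].
  unfold ratio, Rdiv; rewrite Rmult_assoc, Rinv_l by lra; lra.
Qed.

Lemma ratio_prod_ge1 (k : nat) : 1 <= ratio_prod k.
Proof. induction k; simpl; [lra|pose proof (ratio_ge1 k); nra]. Qed.

Lemma ratio_prod_incr (k : nat) : ratio_prod k <= ratio_prod (S k).
Proof.
  pose proof (ratio_prod_ge1 k); pose proof (ratio_ge1 k).
  change (ratio_prod (S k)) with (ratio_prod k * ratio k); nra.
Qed.

Lemma ratio_le (k : nat) : ratio k * (1 - / (xseq (S k) ^ 2)) <= 1.
Proof.
  destruct (alpha_pow_bounds k) as [H _]; pose proof (alpha_pow_ge1 (5 * 2 ^ k)).
  pose proof (xseq_ge k).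
  replace (ratio k * (1 - / (xseq (S k) ^ 2))) with
    ((xseq (S k) - / xseq (S k)) / alpha ^ (5 * 2 ^ k)) by (unfold ratio; field; lra).
  apply Rmult_le_reg_r with (alpha ^ (5 * 2 ^ k)); [lra|].
  unfold Rdiv; rewrite Rmult_assoc, Rinv_l by lra; lra.
Qed.

Lemma xseq_inv_sq_S (k : nat) :
  2 * / (xseq (S (S k)) ^ 2) <= / (xseq (S k) ^ 2) <= / 169.
Proof.
  pose proof (xseq_ge k); pose proof (xseq_ge (S k)); rewrite xseq_rec in *.
  split; [|apply Rinv_le_contravar; nra].
  rewrite <- (Rinv_inv 2) at 1; rewrite <- Rinv_mult.
  apply Rinv_le_contravar; nra.
Qed.

(* The slack factor [1 - 2/x_k^2] absorbs all later factors, each of which is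
   at most [1 / (1 - 1/x_k^2)]. *)
Lemma ratio_prod_le_slack (k : nat) :
  ratio_prod (S (S k)) <= 100301 / 100000 * (1 - 2 * / (xseq (S (S (S k))) ^ 2)).
Proof.
  induction k as [|k IH].
  - unfold ratio_prod, ratio; simpl (5 * _)%nat; rewrite !xseq_rec; simpl xseq.
    pose proof alpha_bounds_sharp.
    pose proof (pow_incr (1669283 / 1000000) alpha 15 ltac:(lra)).
    replace (1 * (13 / alpha ^ 5) * ((13 * 13 - 1) / alpha ^ 10)) with
      (2184 / alpha ^ 15) by (field; lra).
    apply Rmult_le_reg_r with (alpha ^ 15); [lra|].
    unfold Rdiv at 1; rewrite Rmult_assoc, Rinv_l by lra.
    lra.
  - change (ratio_prod (S (S (S k)))) with (ratio_prod (S (S k)) * ratio (S (S k))).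
    pose proof (ratio_le (S (S k))) as Hr; pose proof (ratio_ge1 (S (S k))) as Hr1.
    pose proof (xseq_inv_sq_S (S (S k))) as [Ht' Ht].
    pose proof (xseq_inv_sq_bounds (S (S k))) as [Ht0 _].
    set (t := / (xseq (S (S (S k))) ^ 2)) in *.
    set (t' := / (xseq (S (S (S (S k)))) ^ 2)) in *.
    set (r := ratio (S (S k))) in *.
    assert (ratio_prod (S (S k)) * r <= 100301 / 100000 * (1 - 2 * t) * r)
      by (apply Rmult_le_compat_r; lra).
    (* From [r (1 - t) <= 1] and [1 - 2 t <= (1 - t)^2]; afterwards [2 t' <= t] restores the
       slack. *)
    assert ((1 - 2 * t) * r <= 1 - t) by nra.
    lra.
Qed.

Lemma ratio_prod_le (k : nat) : ratio_prod k <= 100301 / 100000.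
Proof.
  eapply Rle_trans; [|eapply Rle_trans; [apply (ratio_prod_le_slack k)|]].
  - apply Rle_trans with (ratio_prod (S k)); apply ratio_prod_incr.
  - pose proof (xseq_inv_sq_bounds (S (S k))); lra.
Qed.

(** Induction on the number of binary digits of [q]. For a leading one, joining the extremal tree of
    order [5 * 2 ^ k - 1] raises the order by exactly [5 * 2 ^ k], and the [- 1] in the value is
    dropped. For a leading zero the extra factor is at least 1. *)
Lemma has_tree_shift (n0 i0 : nat) : has_tree n0 i0 ->
  forall k q, (q < 2 ^ k)%nat -> exists i, has_tree (n0 + 5 * q) i /\
    INR i + 2 <= (INR i0 + 2) * alpha ^ (5 * q) * ratio_prod k.
Proof.
  intros H0; pose proof (pos_INR i0) as Hi0.
  induction k as [|k IH]; intros q Hq.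
  - exists i0; simpl in Hq; replace q with 0%nat by lia.
    rewrite Nat.mul_0_r, Nat.add_0_r; split; [exact H0|simpl; lra].
  - change (ratio_prod (S k)) with (ratio_prod k * ratio k).
    pose proof (ratio_ge1 k) as Hr; pose proof (ratio_prod_ge1 k) as Hp.
    destruct (Nat.lt_ge_cases q (2 ^ k)) as [Hlt|Hge].
    + destruct (IH q Hlt) as [i [Hi Hle]]; exists i; split; [exact Hi|].
      eapply Rle_trans; [exact Hle|]; pose proof (alpha_pow_ge1 (5 * q)).
      apply Rmult_le_compat_l; [apply Rmult_le_pos|]; nra.
    + destruct (IH (q - 2 ^ k)%nat) as [i [Hi Hle]]; [simpl in Hq; lia|].
      destruct (has_tree_xseq k) as [j [Hj Hjx]].
      destruct (has_tree_join_R _ _ _ _ Hi Hj) as [c [Hc Hcx]].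
      pose proof (Nat.pow_nonzero 2 k ltac:(lia)).
      exists c; split.
      * replace (n0 + 5 * q)%nat with
          (n0 + 5 * (q - 2 ^ k) + (5 * 2 ^ k - 1) + 1)%nat by lia; exact Hc.
      * rewrite Hcx, Hjx; pose proof (xseq_ge k).
        replace (5 * q)%nat with (5 * (q - 2 ^ k) + 5 * 2 ^ k)%nat by lia.
        rewrite pow_add; pose proof (alpha_pow_ge1 (5 * 2 ^ k)).
        assert (Hx : xseq (S k) = alpha ^ (5 * 2 ^ k) * ratio k)
          by (unfold ratio; field; lra).
        apply Rle_trans with ((INR i0 + 2) * alpha ^ (5 * (q - 2 ^ k)) *
          ratio_prod k * xseq (S k)).
        { assert ((INR i + 2) * xseq (S k) <= (INR i0 + 2) *
            alpha ^ (5 * (q - 2 ^ k)) * ratio_prod k * xseq (S k))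
            by (apply Rmult_le_compat_r; lra).
          lra. }
        rewrite Hx; right; ring.
Qed.

(** [d] is a slack at the seed, taken against the full ratio bound. It scales with [alpha ^ (5 * q)]
    and must pay for the final [- 2]. *)
Lemma has_tree_shift_bound (n0 i0 : nat) (q : nat) (d : R) : has_tree n0 i0 ->
  d <= 105 / 100 * alpha ^ (n0 + 1) - (INR i0 + 2) * (100301 / 100000) ->
  2 <= d * alpha ^ (5 * q) ->
  exists i, has_tree (n0 + 5 * q) i /\
    INR i + 2 <= 105 / 100 * alpha ^ (n0 + 5 * q + 1) - 2.
Proof.
  intros H0 Hd H2; pose proof (pos_INR i0) as Hi0.
  (* [q] binary digits suffice since [q < 2 ^ q], and the ratio bound is uniform in their number. *)
  destruct (has_tree_shift _ _ H0 q q) as [i [Hi Hle]].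
  { apply Nat.pow_gt_lin_r; lia. }
  exists i; split; [exact Hi|].
  replace (n0 + 5 * q + 1)%nat with (n0 + 1 + 5 * q)%nat by lia.
  rewrite pow_add; pose proof (alpha_pow_ge1 (5 * q)).
  pose proof (ratio_prod_le q).
  assert ((INR i0 + 2) * alpha ^ (5 * q) * ratio_prod q <=
    (INR i0 + 2) * alpha ^ (5 * q) * (100301 / 100000))
    by (apply Rmult_le_compat_l; [apply Rmult_le_pos|]; lra).
  assert (d * alpha ^ (5 * q) <=
    (105 / 100 * alpha ^ (n0 + 1) - (INR i0 + 2) * (100301 / 100000)) * alpha ^ (5 * q))
    by (apply Rmult_le_compat_r; lra).
  lra.
Qed.

Lemma has_tree_upper (n : nat) : (8 <= n)%nat ->
  exists i, has_tree n i /\ INR i + 2 <= 105 / 100 * alpha ^ (n + 1) - 2.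
Proof.
  intros Hn; pose proof alpha_bounds_sharp as Ha.
  destruct has_tree_small as [[T8 T9 T10 T11 T12] _].
  assert (Hpow : forall m, (1669283 / 1000000) ^ m <= alpha ^ m)
    by (intros m; apply pow_incr; lra).
  pose proof (Nat.div_mod_eq (n - 8) 5) as Hdiv.
  pose proof (Nat.mod_upper_bound (n - 8) 5 ltac:(lia)) as Hmod.
  set (q := ((n - 8) / 5)%nat) in *; set (r := ((n - 8) mod 5)%nat) in *.
  pose proof (alpha_pow_ge1 (5 * q)).
  replace n with (8 + r + 5 * q)%nat by lia.
  clearbody q r; destruct r as [|[|[|[|[|r]]]]]; [| | | | |lia]; clear Hdiv Hmod Hn.
  - apply (has_tree_shift_bound 8 101 q 2 T8); [|lra].
    rewrite INR_IZR_INZ; pose proof (Hpow 9%nat); simpl (8 + 1)%nat; simpl Z.of_nat; lra.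
  - apply (has_tree_shift_bound 9 166 q 2 T9); [|lra].
    rewrite INR_IZR_INZ; pose proof (Hpow 10%nat); simpl (9 + 1)%nat; simpl Z.of_nat; lra.
  - apply (has_tree_shift_bound 10 283 q 2 T10); [|lra].
    rewrite INR_IZR_INZ; pose proof (Hpow 11%nat); simpl (10 + 1)%nat; simpl Z.of_nat; lra.
  - apply (has_tree_shift_bound 11 481 q 2 T11); [|lra].
    rewrite INR_IZR_INZ; pose proof (Hpow 12%nat); simpl (11 + 1)%nat; simpl Z.of_nat; lra.
  (* The seed of order 12 is only guaranteed slack [3 / 100], which scales up to 2 from [q = 2] on;
     the orders 12 and 17 are done by hand. *)
  - destruct q as [|[|q]].
    + exists 816%nat; split; [exact T12|].
      rewrite INR_IZR_INZ; pose proof (Hpow 13%nat); simpl (_ + _)%nat; simpl Z.of_nat; lra.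
    + (* Here [818 * 13 - 1] is too large; two trees of order 8 do better. *)
      destruct (has_tree_join_R _ _ _ _ T8 T8) as [c [Hc Hcx]].
      exists c; split; [exact Hc|]; rewrite Hcx.
      rewrite INR_IZR_INZ; pose proof (Hpow 18%nat); simpl (_ + _)%nat; simpl Z.of_nat; lra.
    + apply (has_tree_shift_bound 12 816 (S (S q)) (3 / 100) T12).
      * rewrite INR_IZR_INZ; pose proof (Hpow 13%nat); simpl (12 + 1)%nat; simpl Z.of_nat; lra.
      * pose proof (alpha_pow_ge 10 (5 * S (S q)) ltac:(lia)); lra.
Qed.

(** * Integer bounds for [m_] *)

Lemma m_lower (n : nat) : (1 <= n)%nat ->
  (Z.of_nat (m_ n) >= Zceil (alpha ^ (n + 1)) - 2)%Z.
Proof.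
  destruct n as [|n]; [lia|intros _].
  pose proof (dominates_le _ _ (m_dominates n)) as H.
  destruct (Zceil_bound (alpha ^ (S n + 1))) as [Hc _].
  rewrite INR_IZR_INZ in H.
  assert (IZR (Zceil (alpha ^ (S n + 1)) - 1) < IZR (Z.of_nat (m_ (S n)) + 2))%R
    by (rewrite minus_IZR, plus_IZR; lra).
  apply lt_IZR in H0; lia.
Qed.

(** [alpha ^ (5 * 2 ^ k)] lies at most [1 / 13] below the integer [xseq (S k)], which is therefore
    its ceiling and is the value of an extremal tree. *)
Lemma m_lower_attained (k : nat) :
  Z.of_nat (m_ (5 * 2 ^ k - 1)) = (Zceil (alpha ^ (5 * 2 ^ k - 1 + 1)) - 2)%Z.
Proof.
  pose proof (Nat.pow_nonzero 2 k ltac:(lia)).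
  pose proof (m_lower (5 * 2 ^ k - 1) ltac:(lia)) as Hl.
  destruct (has_tree_xseq k) as [i [Hi Hix]]; apply m_le_nat in Hi.
  destruct (xseq_integer k) as [z Hz]; rewrite Hz in Hix.
  replace (5 * 2 ^ k - 1 + 1)%nat with (5 * 2 ^ k)%nat in * by lia.
  assert (Hceil : Zceil (alpha ^ (5 * 2 ^ k)) = z).
  { apply Zceil_eq; rewrite <- Hz; pose proof (alpha_pow_bounds k).
    pose proof (xseq_inv_bounds k); lra. }
  rewrite Hceil in *.
  assert (Z.of_nat i + 2 = z)%Z.
  { apply eq_IZR; rewrite plus_IZR, <- INR_IZR_INZ; exact Hix. }
  lia.
Qed.

Lemma m_upper (n : nat) : (8 <= n)%nat ->
  (Z.of_nat (m_ n) <= Zfloor (105 / 100 * alpha ^ (n + 1)) - 4)%Z.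
Proof.
  intros Hn; destruct (has_tree_upper n Hn) as [i [Hi Hle]]; apply m_le_nat in Hi.
  assert (Z.of_nat i + 4 <= Zfloor (105 / 100 * alpha ^ (n + 1)))%Z.
  { apply Zfloor_lub; rewrite plus_IZR, <- INR_IZR_INZ; lra. }
  lia.
Qed.

End Extremal.

Theorem theorem5p1 :
  (forall n : nat, (1 <= n)%nat ->
     (Z.of_nat (m_ n) >= Zceil (alpha ^ (n + 1)) - 2)%Z) /\
  (forall N : nat, exists n : nat, (N <= n)%nat /\ (1 <= n)%nat /\
     Z.of_nat (m_ n) = (Zceil (alpha ^ (n + 1)) - 2)%Z) /\
  (forall n : nat, (8 <= n)%nat ->
     (Z.of_nat (m_ n) <= Zfloor (105 / 100 * alpha ^ (n + 1)) - 4)%Z).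
Proof.
  split; [exact Extremal.m_lower|split; [|exact Extremal.m_upper]].
  intros N; exists (5 * 2 ^ N - 1)%nat.
  pose proof (Nat.pow_gt_lin_r 2 N (le_n 2)) as HN.
  split; [Lia.lia|split; [Lia.lia|apply Extremal.m_lower_attained]].
Qed.
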